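(* Let $G$ be a simple graph of order $n$ and let $v\in V(G)$ be a vertex of degree $d_v$. For every $k\in[0,d_v+1]$, $$\rho^2(G)-\rho^2(G-v)\le 2d_v-1+(k-2)\left(\frac{d_v}{\rho(G)}-1\right).$$ If $G$ is connected, the equality holds if and only if either $G\cong K_n$, or $G\cong K_{1,n-1}$ when $d_v=1$ and $k=2$.
   Context: For a simple graph $G$, $\rho(G)$ denotes the spectral radius (largest eigenvalue) of the adjacency matrix $A(G)$ of $G$. $V(G)$ is the vertex set of $G$, and the order of $G$ is $|V(G)|$. $G-v$ is the graph obtained from $G$ by deleting the vertex $v$ and all edges incident to $v$. $K_n$ is the complete graph on $n$ vertices and $K_{1,n-1}$ is the star on $n$ vertices. The parameter $k$ is real. *)

(* Defs.v *)
From HB Require Import structures.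
From mathcomp Require Import all_boot all_order all_algebra.
From mathcomp Require Import all_classical all_reals.
Set Implicit Arguments.
Unset Strict Implicit.
Unset Printing Implicit Defensive.
Import Order.TTheory GRing.Theory Num.Theory.
Local Open Scope ring_scope.

Record sgraph := SGraph {
  vertex :> finType;
  adj : rel vertex;
  adj_sym : symmetric adj;
  adj_irr : irreflexive adj }.

Definition degree (G : sgraph) (v : G) : nat := #|[set u | adj v u]|.

Definition connected (G : sgraph) : Prop :=
  (0 < #|G|)%N /\ forall x y : G, connect (@adj G) x y.

Definition isomorphic (G H : sgraph) : Prop :=
  exists f : G -> H, bijective f /\ forall x y, adj (f x) (f y) = adj x y.

Section DeleteVertex.
Variables (G : sgraph) (v : G).

Definition del_adj : rel {u : G | u != v} := fun x y => adj (val x) (val y).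

Lemma del_adj_sym : symmetric del_adj.
Proof. by move=> x y; rewrite /del_adj adj_sym. Qed.

Lemma del_adj_irr : irreflexive del_adj.
Proof. by move=> x; rewrite /del_adj adj_irr. Qed.

Definition del_vertex : sgraph := SGraph del_adj_sym del_adj_irr.
End DeleteVertex.

Section Complete.
Variable n : nat.

Definition complete_adj : rel 'I_n := fun i j => i != j.

Lemma complete_adj_sym : symmetric complete_adj.
Proof. by move=> i j; rewrite /complete_adj eq_sym. Qed.

Lemma complete_adj_irr : irreflexive complete_adj.
Proof. by move=> i; rewrite /complete_adj eqxx. Qed.

Definition complete : sgraph := SGraph complete_adj_sym complete_adj_irr.
End Complete.

Section CompleteBipartite.
Variables s t : nat.

Definition bipartite_adj : rel ('I_s + 'I_t)%type := fun x y =>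
  match x, y with
  | inl _, inr _ | inr _, inl _ => true
  | _, _ => false
  end.

Lemma bipartite_adj_sym : symmetric bipartite_adj.
Proof. by case=> [i|i] [j|j]. Qed.

Lemma bipartite_adj_irr : irreflexive bipartite_adj.
Proof. by case. Qed.

Definition complete_bipartite : sgraph :=
  SGraph bipartite_adj_sym bipartite_adj_irr.
End CompleteBipartite.

Definition adj_mx (R : realType) (G : sgraph) : 'M[R]_#|G| :=
  \matrix_(i, j) (adj (enum_val i) (enum_val j))%:R.

(* The spectrum of A(G) is finite, and it is nonempty when G has a vertex since
   A(G) is real symmetric, so this supremum is the largest eigenvalue. For the
   graph without vertices it is sup set0 = 0. *)
Definition rho (R : realType) (G : sgraph) : R :=
  sup [set a : R | eigenvalue (adj_mx R G) a]%classic.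

(* Main.v *)
Require Import Defs.
From mathcomp Require Import all_boot all_order all_algebra all_classical all_reals.
From mathcomp Require Import ring lra.
Set Implicit Arguments.
Unset Strict Implicit.
Unset Printing Implicit Defensive.
Import Order.TTheory GRing.Theory Num.Theory.
Local Open Scope ring_scope.

(** Write A and B for the adjacency operators of G and G - v, both acting on
    functions on the vertices of G (B vanishes at v), and rho, r for their
    spectral radii; let c be the indicator of the neighbourhood of v and
    d = <c, c> the degree. If x is a Perron vector of G, t = x v, and y is x
    with its value at v replaced by 0, then the eigenvalue equation of x splits
    into B y = rho y - t c and <c, y> = rho t. These two equations give two
    estimates of the drop rho^2 - r^2.

    - The Rayleigh quotient of B at y and Cauchy-Schwarz for <c, y> give
      rho^2 - d <= r rho. Squaring (d <= rho^2, because A maps the indicator of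
      v to c) and completing the square (rho - d)^2 >= 0 bounds the drop by
      2d + 1 - 2d/rho, the right-hand side at k = 0
      ([sqr_rho_drop_le_rayleigh]).
    - The operator (rho - B)(r^2 - B^2) is positive semidefinite when r < rho.
      Evaluated at y it gives rho^3 <= r^2 rho + rho d + <c, B c>, and
      <c, B c>, twice the number of edges between neighbours of v, is at most
      d(d - 1). This bounds the drop by d + d(d - 1)/rho, the right-hand side
      at k = d + 1 ([sqr_rho_drop_le_cubic]).

    The right-hand side of the theorem is affine in k, hence a convex
    combination of these two bounds.

    Equality for some k means equality in the first bound or, when k = d + 1, in
    the second. In the first case rho = d and y is proportional to c; as y is
    positive off v, every vertex is a neighbour of v and x is constant, so G is
    regular of degree n - 1 ([complete_of_rayleigh_eq]). In the second case the
    neighbourhood of v is a clique and B^2 y = r^2 y, which forces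
    B^2 c = r^2 c: no walk of length two in G - v joins a non-neighbour of v to
    a neighbour of v. Non-neighbours, if any, are however attached to neighbours
    of v, so a second neighbour would create such a walk through the clique.
    Hence either there are none and G is complete, or v has a single neighbour,
    which is the centre of a star ([shape_of_cubic_eq]). The converse computes the spectral radii of complete
    graphs and stars from explicit positive eigenvectors.

    The spectral radius is handled variationally: the least upper bound of the
    Rayleigh quotient is an eigenvalue ([rayleigh_max]), and replacing an
    eigenvector by its absolute value gives a Perron vector ([perron]). *)

(** * Symmetric kernels as operators on functions *)

Section Kernels.
Variables (R : realFieldType) (V : finType).
Implicit Types (x y z w : V -> R) (m : V -> V -> R).

Definition dot x y : R := \sum_i x i * y i.

Definition app m x : V -> R := fun i => \sum_j m i j * x j.

Definition comb (s : R) x (t : R) y : V -> R := fun i => s * x i + t * y i.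

Lemma dotC x y : dot x y = dot y x.
Proof. by apply: eq_bigr => i _; rewrite mulrC. Qed.

Lemma eq_dotr x y z : y =1 z -> dot x y = dot x z.
Proof. by move=> e; apply: eq_bigr => i _; rewrite e. Qed.

Lemma dot_combr x s y t z : dot x (comb s y t z) = s * dot x y + t * dot x z.
Proof.
rewrite /dot !mulr_sumr -big_split; apply: eq_bigr => i _ /=.
by rewrite /comb; ring.
Qed.

Lemma dot_combl x s y t z : dot (comb s y t z) x = s * dot y x + t * dot z x.
Proof. by rewrite dotC dot_combr !(dotC x). Qed.

Lemma eq_app m x y : x =1 y -> app m x =1 app m y.
Proof. by move=> e i; apply: eq_bigr => j _; rewrite e. Qed.

Lemma app_comb m s x t y : app m (comb s x t y) =1 comb s (app m x) t (app m y).
Proof.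
move=> i; rewrite /comb /app !mulr_sumr -big_split; apply: eq_bigr => j _ /=.
by rewrite /comb; ring.
Qed.

Lemma dot_app m x y : (forall i j, m i j = m j i) ->
  dot x (app m y) = dot (app m x) y.
Proof.
move=> msym; rewrite /dot /app.
under eq_bigr do rewrite mulr_sumr.
rewrite exchange_big; apply: eq_bigr => j _; rewrite mulr_suml.
by apply: eq_bigr => i _ /=; rewrite (msym j i); ring.
Qed.

Lemma dot_ge0 x : 0 <= dot x x.
Proof. by apply: sumr_ge0 => i _; rewrite -expr2 sqr_ge0. Qed.

Lemma dot_eq0 x : dot x x = 0 -> forall i, x i = 0.
Proof.
move=> /eqP; rewrite psumr_eq0 => [/allP h i|i _]; last by rewrite -expr2 sqr_ge0.
by have := h i (mem_index_enum _); rewrite -expr2 sqrf_eq0 => /eqP.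
Qed.

Lemma dot_gt0 x i : x i != 0 -> 0 < dot x x.
Proof.
move=> xi; rewrite lt_def dot_ge0 andbT; apply: contraNneq xi => /dot_eq0 ->.
by rewrite eqxx.
Qed.

(** A positive semidefinite binary quadratic form has nonpositive discriminant;
    the case distinction covers degenerate forms. *)
Lemma discriminant (a b c : R) :
  (forall s t, 0 <= s ^+ 2 * a + 2 * s * t * b + t ^+ 2 * c) ->
  b ^+ 2 <= a * c.
Proof.
move=> h.
have a0 : 0 <= a by have := h 1 0; lra.
have c0 : 0 <= c by have := h 0 1; lra.
have [c_gt0|] := ltP 0 c.
  have := h c (- b).
  have -> : c ^+ 2 * a + 2 * c * - b * b + (- b) ^+ 2 * c = c * (a * c - b ^+ 2) by ring.
  by rewrite pmulr_rge0 // subr_ge0.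
move=> c_le0; have {c_le0} {}c0 : c = 0 by apply/eqP; rewrite eq_le c_le0.
have [a_gt0|] := ltP 0 a.
  have := h (- b) a.
  have -> : (- b) ^+ 2 * a + 2 * - b * a * b + a ^+ 2 * c = a * (a * c - b ^+ 2) by ring.
  by rewrite pmulr_rge0 // subr_ge0.
move=> a_le0; have {a_le0} {}a0 : a = 0 by apply/eqP; rewrite eq_le a_le0.
by have := h 1 (- b); rewrite a0 c0; lra.
Qed.

Lemma form_comb m s x t y : (forall i j, m i j = m j i) ->
  dot (comb s x t y) (app m (comb s x t y)) =
  s ^+ 2 * dot x (app m x) + 2 * s * t * dot x (app m y)
  + t ^+ 2 * dot y (app m y).
Proof.
move=> msym; rewrite (eq_dotr _ (app_comb m s x t y)) dot_combl !dot_combr.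
by rewrite (dot_app y x msym) (dotC _ x); ring.
Qed.

Lemma dot_comb s x t y :
  dot (comb s x t y) (comb s x t y) =
  s ^+ 2 * dot x x + 2 * s * t * dot x y + t ^+ 2 * dot y y.
Proof. by rewrite dot_combl !dot_combr (dotC y x); ring. Qed.

Lemma cauchy_schwarz x y : dot x y ^+ 2 <= dot x x * dot y y.
Proof. by apply: discriminant => s t; rewrite -dot_comb dot_ge0. Qed.

Lemma cauchy_schwarz_form m x y : (forall i j, m i j = m j i) ->
    (forall w, 0 <= dot w (app m w)) ->
  dot x (app m y) ^+ 2 <= dot x (app m x) * dot y (app m y).
Proof. by move=> msym mpos; apply: discriminant => s t; rewrite -form_comb. Qed.

(** Cauchy-Schwarz for the semidefinite form, applied to [app m y] and [y]: an
    isotropic vector of such a form lies in its radical. *)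
Lemma form_eq0_ker m y : (forall i j, m i j = m j i) ->
    (forall w, 0 <= dot w (app m w)) ->
  dot y (app m y) = 0 -> forall i, app m y i = 0.
Proof.
move=> msym mpos y0; apply: dot_eq0.
have := cauchy_schwarz_form (app m y) y msym mpos.
rewrite y0 mulr0 => h.
by apply/eqP; rewrite -sqrf_eq0 eq_le h sqr_ge0.
Qed.

(** The operator [a I + s m]; spectral bounds on [m] become positivity of such
    shifts. *)
Definition shift (a s : R) m : V -> V -> R :=
  fun i j => a * (i == j)%:R + s * m i j.

Lemma app_shift a s m x i : app (shift a s m) x i = a * x i + s * app m x i.
Proof.
rewrite /app mulr_sumr (bigD1 i) //= [in RHS](bigD1 i) //= /shift eqxx.
rewrite mulrDl -!addrA mulr1 mulrA; congr (_ + (_ + _)).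
by apply: eq_bigr => j ji; rewrite eq_sym (negPf ji) mulr0 add0r mulrA.
Qed.

Lemma form_shift a s m x :
  dot x (app (shift a s m) x) = a * dot x x + s * dot x (app m x).
Proof. by rewrite (eq_dotr _ (app_shift a s m x)) -/(comb _ _ _ _) dot_combr. Qed.

Lemma shift_sym a s m : (forall i j, m i j = m j i) ->
  forall i j, shift a s m i j = shift a s m j i.
Proof. by move=> msym i j; rewrite /shift eq_sym msym. Qed.

(** Each entry contributes at most [|m i j| |x i| |x j|], and
    [2 |x i| |x j| <= x i ^+ 2 + x j ^+ 2]. *)
Lemma form_le_norm m x :
  dot x (app m x) <= (\sum_i \sum_j `|m i j|) * dot x x.
Proof.
rewrite mulr_suml; apply: ler_sum => i _.
rewrite mulr_sumr mulr_suml; apply: ler_sum => j _.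
have le1 k : x k ^+ 2 <= dot x x.
  rewrite /dot (bigD1 k) //= expr2 lerDl sumr_ge0 // => l _.
  by rewrite -expr2 sqr_ge0.
have h := sqr_ge0 (`|x i| - `|x j|).
rewrite sqrrB !real_normK ?num_real // in h.
apply: (le_trans (ler_norm _)); rewrite mulrCA normrM; apply: ler_wpM2l => //.
rewrite normrM; have := le1 i; have := le1 j; lra.
Qed.

Lemma sum_enum_val (F : V -> R) : \sum_i F i = \sum_(k < #|V|) F (enum_val k).
Proof. exact: reindex (onW_bij _ (@enum_val_bij V)). Qed.

(** The alternative is whether the determinant of the matrix of [m] vanishes. *)
Lemma kernel_or_inverse m :
  (exists2 x, exists i, x i != 0 & forall i, app m x i = 0) \/
  exists g, forall x, app m (app g x) =1 x.
Proof.
pose M : 'M[R]_#|V| := \matrix_(i, j) m (enum_val i) (enum_val j).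
have [/eqP/det0P [u u0 uM]|Mu] := eqVneq (\det M^T) 0.
  left; exists (fun i => u 0 (enum_rank i)).
    have /rV0Pn [k uk] := u0.
    by exists (enum_val k); rewrite enum_valK.
  move=> i; rewrite /app sum_enum_val.
  have := congr1 (fun w : 'rV_#|V| => w 0 (enum_rank i)) uM.
  rewrite !mxE => {2}<-; apply: eq_bigr => k _.
  by rewrite !mxE enum_rankK enum_valK mulrC.
right; exists (fun i j => invmx M (enum_rank i) (enum_rank j)) => x i.
have MV : M *m invmx M = 1%:M by rewrite mulmxV // unitmxE unitfE -det_tr.
rewrite /app; under eq_bigr do rewrite mulr_sumr.
rewrite exchange_big (bigD1 i) //= [X in _ + X]big1 ?addr0.
  have := congr1 (fun w : 'M_#|V| => w (enum_rank i) (enum_rank i)) MV.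
  rewrite !mxE eqxx => e; rewrite sum_enum_val -[RHS]mul1r -[X in _ = X * _]e mulr_suml.
  by apply: eq_bigr => k _; rewrite !mxE enum_rankK enum_valK mulrA.
move=> j ji.
have := congr1 (fun w : 'M_#|V| => w (enum_rank i) (enum_rank j)) MV.
rewrite !mxE (inj_eq enum_rank_inj) eq_sym (negPf ji) => e.
rewrite sum_enum_val -[RHS](mul0r (x j)) -[X in _ = X * _]e mulr_suml.
by apply: eq_bigr => k _; rewrite !mxE enum_rankK enum_valK mulrA.
Qed.

End Kernels.

(** * The maximum of the Rayleigh quotient *)

Section Rayleigh.
Variables (R : realType) (V : finType).
Implicit Types m g : V -> V -> R.

(** With [m (g w) = w], Cauchy-Schwarz for the form of [m] gives
    [<w, w>^2 = <w, m (g w)>^2 <= <w, m w> <g w, w>], and [<g w, w>] is at most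
    a constant times [<w, w>]. *)
Lemma positive_form_coercive m g : (forall i j, m i j = m j i) ->
    (forall w, 0 <= dot w (app m w)) -> (forall x, app m (app g x) =1 x) ->
  exists2 e : R, 0 < e & forall w, e * dot w w <= dot w (app m w).
Proof.
pose C := 1 + \sum_i \sum_j `|g i j|.
have C0 : 0 < C.
  by rewrite ltr_wpDr ?ltr01 // sumr_ge0 // => i _; rewrite sumr_ge0.
move=> msym mpos mg.
exists C^-1 => [|w]; first by rewrite invr_gt0.
have gw : dot (app g w) w <= C * dot w w.
  rewrite dotC; apply: (le_trans (form_le_norm g w)).
  by rewrite ler_wpM2r ?dot_ge0 // lerDr.
have := cauchy_schwarz_form w (app g w) msym mpos.
rewrite !(eq_dotr _ (mg w)) => cs.
have := dot_ge0 w; rewrite le_eqVlt => /predU1P [<-|w0]; first by rewrite mulr0.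
rewrite ler_pdivrMl // -(ler_pM2l w0) -expr2; apply: (le_trans cs).
have -> : dot w w * (C * dot w (app m w)) = dot w (app m w) * (C * dot w w) by ring.
exact: ler_wpM2l.
Qed.

(** Take for [lam] the infimum of the constants that bound the form. Were
    [lam I - m] invertible, its form would be coercive and a smaller constant
    would still be a bound; so [lam I - m] has a kernel. *)
Lemma rayleigh_max m : (forall i j, m i j = m j i) -> (0 < #|V|)%N ->
  exists2 lam : R, forall w, dot w (app m w) <= lam * dot w w &
    exists2 x, exists i, x i != 0 & app m x =1 (fun i => lam * x i).
Proof.
move=> msym /card_gt0P [i0 _].
pose S : set R := [set c | forall w, dot w (app m w) <= c * dot w w]%classic.
pose e : V -> R := fun i => (i == i0)%:R.
have e1 : dot e e = 1.
  rewrite /dot (bigD1 i0) //= big1 => [|i /negPf ii]; rewrite /e.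
    by rewrite eqxx mulr1 addr0.
  by rewrite ii mulr0.
have S0 : (S !=set0)%classic.
  by exists (\sum_i \sum_j `|m i j|) => w; exact: form_le_norm.
have Slb : has_lbound S by exists (dot e (app m e)) => c /(_ e); rewrite e1 mulr1.
have lamS : S (inf S).
  move=> w; have := dot_ge0 w; rewrite le_eqVlt => /predU1P [w0|w0].
    rewrite -w0 mulr0 /dot big1 // => i _.
    by rewrite (dot_eq0 (esym w0)) mul0r.
  rewrite -ler_pdivrMr //; apply: lb_le_inf => // c Sc.
  by rewrite ler_pdivrMr.
exists (inf S) => //.
have psd w : 0 <= dot w (app (shift (inf S) (-1) m) w).
  by rewrite form_shift mulN1r subr_ge0; exact: lamS.
have [[x x0 xk]|[g mg]] := kernel_or_inverse (shift (inf S) (-1) m).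
  exists x => // i; have := xk i; rewrite app_shift mulN1r => /eqP.
  by rewrite subr_eq0 => /eqP.
have [c c0 cw] : exists2 c : R, 0 < c &
    forall w, c * dot w w <= dot w (app (shift (inf S) (-1) m) w).
  exact: positive_form_coercive (shift_sym _ _ msym) psd mg.
suff : inf S <= inf S - c by rewrite lerBrDr gerDl leNgt c0.
apply: ge_inf => // w; have := cw w; rewrite form_shift; lra.
Qed.

End Rayleigh.

(** * The spectral radius of a graph *)

Section SpectralRadius.
Variable R : realType.
Implicit Types G : sgraph.

Definition adj_ker G : G -> G -> R := fun i j => (adj i j)%:R.
Arguments adj_ker : clear implicits.

Lemma adj_ker_sym G i j : adj_ker G i j = adj_ker G j i.
Proof. by rewrite /adj_ker adj_sym. Qed.

Lemma eigenvalue_adj_mxP G a : eigenvalue (adj_mx R G) a <->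
  exists2 x : G -> R, exists i, x i != 0 & app (adj_ker G) x =1 (fun i => a * x i).
Proof.
split=> [/eigenvalueP [u uA u0]|[x [i xi] xA]].
  exists (fun i => u 0 (enum_rank i)).
    have /rV0Pn [k uk] := u0.
    by exists (enum_val k); rewrite enum_valK.
  move=> i; rewrite /app sum_enum_val.
  have := congr1 (fun w : 'rV_#|G| => w 0 (enum_rank i)) uA.
  rewrite !mxE => <-; apply: eq_bigr => k _.
  by rewrite !mxE enum_rankK enum_valK mulrC adj_ker_sym.
apply/eigenvalueP; exists (\row_k x (enum_val k)).
  apply/rowP => k; rewrite !mxE -xA /app [RHS]sum_enum_val; apply: eq_bigr => l _.
  by rewrite !mxE mulrC adj_ker_sym.
by apply/rV0Pn; exists (enum_rank i); rewrite mxE enum_rankK.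
Qed.

Lemma eigenvalue_le (V : finType) (m : V -> V -> R) (lam a : R) (x : V -> R) i :
    (forall w, dot w (app m w) <= lam * dot w w) ->
  x i != 0 -> app m x =1 (fun i => a * x i) -> a <= lam.
Proof.
move=> mlam /dot_gt0 x0 xA; rewrite -(ler_pM2r x0); apply: le_trans (mlam x).
rewrite (eq_dotr _ xA) /dot mulr_sumr; apply: ler_sum => j _.
by rewrite mulrCA.
Qed.

Lemma rho_max G : (0 < #|G|)%N ->
  (forall w, dot w (app (adj_ker G) w) <= rho R G * dot w w) /\
  exists2 x, exists i, x i != 0 & app (adj_ker G) x =1 (fun i => rho R G * x i).
Proof.
move=> /(rayleigh_max (@adj_ker_sym G)) [lam lam_max lam_eig].
suff -> : rho R G = lam by [].
have lamE : eigenvalue (adj_mx R G) lam by apply/eigenvalue_adj_mxP.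
have ub : ubound [set a | eigenvalue (adj_mx R G) a]%classic lam.
  move=> a /eigenvalue_adj_mxP [x [i xi] xA].
  exact: eigenvalue_le lam_max xi xA.
apply/eqP; rewrite eq_le; apply/andP; split.
  by apply: ge_sup => //; exists lam.
by apply: ub_le_sup => //; exists lam.
Qed.

Lemma rho_graph0 G : #|G| = 0%N -> rho R G = 0.
Proof.
move=> G0; rewrite /rho; have -> : [set a | eigenvalue (adj_mx R G) a]%classic = set0.
  apply/seteqP; split=> // a /eigenvalue_adj_mxP [x [i _] _].
  by have := fintype0 i.
exact: sup0.
Qed.

Lemma rayleigh_rho G w : dot w (app (adj_ker G) w) <= rho R G * dot w w.
Proof.
have [G0|] := posnP #|G|; last by move=> /rho_max [].
by rewrite rho_graph0 // mul0r /dot big1 // => i; have := fintype0 i.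
Qed.

Lemma rho_ge0 G : 0 <= rho R G.
Proof.
have [G0|/card_gt0P [i _]] := posnP #|G|; first by rewrite rho_graph0.
pose e : G -> R := fun j => (j == i)%:R.
have e0 : 0 < dot e e by apply: (@dot_gt0 _ _ _ i); rewrite /e eqxx oner_eq0.
rewrite -(pmulr_lge0 _ e0); apply: le_trans (rayleigh_rho e).
apply: sumr_ge0 => j _; rewrite mulr_ge0 ?ler0n //.
by apply: sumr_ge0 => k _; rewrite mulr_ge0 ?ler0n.
Qed.

(** The entries of the adjacency operator are nonnegative, so absolute values
    only increase the form. *)
Lemma form_le_abs G (w : G -> R) :
  `|dot w (app (adj_ker G) w)| <=
    dot (fun i => `|w i|) (app (adj_ker G) (fun i => `|w i|)).
Proof.
apply: (le_trans (ler_norm_sum _ _ _)); apply: ler_sum => i _.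
rewrite normrM ler_wpM2l //; apply: (le_trans (ler_norm_sum _ _ _)).
by apply: ler_sum => j _; rewrite normrM ger0_norm ?ler0n.
Qed.

Lemma dot_abs (V : finType) (w : V -> R) :
  dot (fun i => `|w i|) (fun i => `|w i|) = dot w w.
Proof.
by apply: eq_bigr => i _; rewrite -!expr2 real_normK ?num_real.
Qed.

(** No eigenvalue is smaller than [- rho]: this two-sided bound is what makes
    both [rho I + A] and [rho I - A] semidefinite. *)
Lemma rayleigh_rho_abs G w : `|dot w (app (adj_ker G) w)| <= rho R G * dot w w.
Proof. by rewrite -dot_abs; apply: le_trans (form_le_abs w) (rayleigh_rho _). Qed.

(** The absolute value of a top eigenvector still maximises the Rayleigh
    quotient, hence is isotropic for the semidefinite form of [rho I - A]. *)
Lemma perron G : (0 < #|G|)%N ->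
  exists x, [/\ forall i, 0 <= x i, exists i, x i != 0 &
    app (adj_ker G) x =1 (fun i => rho R G * x i)].
Proof.
move=> /rho_max [_ [x [i xi] xA]]; pose z i := `|x i|.
exists z; split=> [j|| j]; rewrite ?normr_ge0 //.
  by exists i; rewrite normr_eq0.
have sh_form w : dot w (app (shift (rho R G) (-1) (adj_ker G)) w) =
    rho R G * dot w w - dot w (app (adj_ker G) w).
  by rewrite form_shift mulN1r.
have := @form_eq0_ker _ _ (shift (rho R G) (-1) (adj_ker G)) z.
rewrite sh_form => /(_ (shift_sym _ _ (@adj_ker_sym G))) h.
have /h {h} ker : forall w, 0 <= dot w (app (shift (rho R G) (-1) (adj_ker G)) w).
  by move=> w; rewrite sh_form subr_ge0; exact: rayleigh_rho.
have /ker {ker} /(_ j) : rho R G * dot z z - dot z (app (adj_ker G) z) = 0.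
  apply/eqP; rewrite eq_le [X in _ && X]subr_ge0 rayleigh_rho andbT subr_le0.
  apply: le_trans (form_le_abs x); apply: le_trans (ler_norm _).
  rewrite (eq_dotr _ xA) dot_abs /dot mulr_sumr.
  by apply: ler_sum => k _; rewrite mulrCA.
by rewrite app_shift mulN1r => /eqP; rewrite subr_eq0 => /eqP.
Qed.

(** The zero set of a nonnegative eigenvector is closed under adjacency. *)
Lemma perron_gt0 G x : connected G -> (forall i, 0 <= x i) -> (exists i, x i != 0) ->
  app (adj_ker G) x =1 (fun i => rho R G * x i) -> forall i, 0 < x i.
Proof.
move=> [_ Gc] x0 [i xi] xA j; rewrite lt_def x0 andbT.
have csym : connect_sym (@adj G) by apply: sym_connect_sym; exact: adj_sym.
have cl : closed (@adj G) [pred k | x k == 0].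
  apply: (intro_closed csym) => k l kl; rewrite !inE => /eqP xk.
  have := xA k; rewrite xk mulr0 => /eqP; rewrite psumr_eq0 => [/allP /(_ l)|k' _].
    by rewrite mem_index_enum /adj_ker kl mul1r; exact.
  by rewrite mulr_ge0 ?ler0n.
by have := closed_connect cl (Gc i j); rewrite !inE (negPf xi) => <-.
Qed.

(** Pairing with a Perron vector, which has a nonzero inner product with any
    positive vector. Working with the square of the operator lets the constant
    vector serve for stars as well as for complete graphs. *)
Lemma rho_sqr_positive G x (mu : R) : (0 < #|G|)%N -> (forall i, 0 < x i) ->
  app (adj_ker G) (app (adj_ker G) x) =1 (fun i => mu * x i) ->
  rho R G ^+ 2 = mu.
Proof.
move=> /perron [z [z0 [i zi] zA]] x0 xA.
have zx : dot z x != 0.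
  rewrite gt_eqF // /dot (bigD1 i) //= ltr_pwDl ?mulr_gt0 //.
    by rewrite lt_def zi z0.
  by apply: sumr_ge0 => j _; rewrite mulr_ge0 // ltW.
have zAr y : dot z (app (adj_ker G) y) = rho R G * dot z y.
  rewrite dot_app; last exact: adj_ker_sym.
  rewrite dotC (eq_dotr _ zA) dotC /dot mulr_sumr.
  by apply: eq_bigr => j _; rewrite mulrA.
apply: (mulIf zx); rewrite expr2 -mulrA -!zAr (eq_dotr _ xA) /dot mulr_sumr.
by apply: eq_bigr => j _; rewrite mulrCA.
Qed.

Section Deletion.
Variables (G : sgraph) (v : G).

(** The adjacency operator of [G - v], extended by zero to functions on [G], so
    that vectors of both graphs live in one space. *)
Definition del_ker : G -> G -> R :=
  fun i j => [&& i != v, j != v & adj i j]%:R.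

Lemma del_ker_sym i j : del_ker i j = del_ker j i.
Proof. by rewrite /del_ker adj_sym andbCA. Qed.

Lemma sum_del_vertex (F : G -> R) :
  \sum_(i : del_vertex v) F (val i) = \sum_(i | i != v) F i.
Proof. by rewrite (big_sub [pred u | u != v]). Qed.

Lemma rayleigh_del_ker w :
  `|dot w (app del_ker w)| <= rho R (del_vertex v) * dot w w.
Proof.
pose u (i : del_vertex v) := w (val i).
have -> : dot w (app del_ker w) = dot u (app (adj_ker (del_vertex v)) u).
  rewrite /dot (bigD1 v) //= {1}/app big1 => [|j _].
    rewrite mulr0 add0r -sum_del_vertex; apply: eq_bigr => -[i iv] _.
    rewrite /app (bigD1 v) //= {1}/del_ker eqxx andbF mul0r add0r.
    rewrite -sum_del_vertex; congr (_ * _); apply: eq_bigr => -[j jv] _.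
    by rewrite /del_ker /= iv jv.
  by rewrite /del_ker eqxx mul0r.
apply: (le_trans (rayleigh_rho_abs u)); rewrite ler_wpM2l ?rho_ge0 //.
rewrite /dot (sum_del_vertex (fun i => w i * w i)) [leRHS](bigD1 v) //=.
by rewrite lerDr -expr2 sqr_ge0.
Qed.

End Deletion.
End SpectralRadius.

(** * Eigenvectors of a bordered operator *)

(** The setting is that of an eigenvector [(t, y)] for [lam] of the operator
    obtained by bordering [b] with the row and column [c] and corner 0: its
    eigenvalue equations are [by_eq] and [cy_eq]. The number [r] bounds the
    spectrum of [b] on both sides. *)
Section Bordered.
Variables (R : realFieldType) (V : finType) (b : V -> V -> R) (r : R).
Hypothesis bsym : forall i j, b i j = b j i.
Hypothesis r_ge0 : 0 <= r.
Hypothesis b_bound : forall w, `|dot w (app b w)| <= r * dot w w.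

Lemma form_le w : dot w (app b w) <= r * dot w w.
Proof. exact: le_trans (ler_norm _) (b_bound w). Qed.

Lemma form_ge w : 0 <= r * dot w w + dot w (app b w).
Proof. by have := b_bound w; rewrite ler_norml => /andP [h _]; lra. Qed.

(** Polarisation: subtract the bounds on the form at [u + s (b u)] and
    [u - s (b u)], and take the optimal [s = 1 / r]. *)
Lemma norm_app_le u : dot (app b u) (app b u) <= r ^+ 2 * dot u u.
Proof.
set z := app b u.
have polar s : 2 * s * dot z z <= r * (dot u u + s ^+ 2 * dot z z).
  have := form_le (comb 1 u s z); have := form_ge (comb 1 u (- s) z).
  by rewrite !form_comb // !dot_comb (dot_app u z bsym) -/z; lra.
move: r_ge0; rewrite le_eqVlt => /predU1P [r0|r_gt0].
  by have := polar 1; rewrite -r0; lra.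
have := polar r^-1; rewrite -(ler_pM2l r_gt0).
have -> : r * (2 * r^-1 * dot z z) = 2 * dot z z by field; rewrite gt_eqF.
have -> : r * (r * (dot u u + r^-1 ^+ 2 * dot z z)) = r ^+ 2 * dot u u + dot z z.
  by field; rewrite gt_eqF.
by lra.
Qed.

Variables (y c : V -> R) (lam t : R).
Hypothesis by_eq : app b y =1 comb lam y (- t) c.
Hypothesis cy_eq : dot c y = lam * t.

Lemma bordered_form : dot y (app b y) = lam * (dot y y - t ^+ 2).
Proof. by rewrite (eq_dotr _ by_eq) dot_combr (dotC y c) cy_eq; ring. Qed.

(** Multiply the Rayleigh bound [lam (<y, y> - t^2) <= r <y, y>] by [lam] and use
    [(lam t)^2 = <c, y>^2 <= <c, c> <y, y>]. *)
Lemma bordered_rayleigh : 0 < lam -> 0 < dot y y ->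
  lam ^+ 2 - dot c c <= r * lam.
Proof.
move=> lam0 y0; have := form_le y; rewrite bordered_form => h.
have := cauchy_schwarz c y; rewrite cy_eq => cs.
rewrite -(ler_pM2r y0).
have := ler_wpM2l (ltW lam0) h; nra.
Qed.

(** Equality above is equality in Cauchy-Schwarz, so [y] is proportional to [c]. *)
Lemma bordered_rayleigh_eq : 0 < lam -> 0 < dot y y -> 0 < dot c c ->
  r * lam = lam ^+ 2 - dot c c ->
  forall i, dot c c * y i = lam * t * c i.
Proof.
move=> lam0 y0 c0 e i; have := form_le y; rewrite bordered_form => h.
have := cauchy_schwarz c y; rewrite cy_eq => cs.
have {}h := ler_wpM2l (ltW lam0) h.
have {}cs : (lam * t) ^+ 2 = dot c c * dot y y.
  apply/eqP; rewrite eq_le cs /=.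
  have : lam * (r * dot y y) = (lam ^+ 2 - dot c c) * dot y y by rewrite -e; ring.
  by move=> e'; rewrite e' in h; lra.
have : dot (comb (dot c c) y (- (lam * t)) c) (comb (dot c c) y (- (lam * t)) c) = 0.
  rewrite dot_comb (dotC y c) cy_eq.
  transitivity (dot c c * (dot c c * dot y y - (lam * t) ^+ 2)); first by ring.
  by rewrite cs subrr mulr0.
by move=> /dot_eq0 /(_ i); rewrite /comb; lra.
Qed.

Let w := comb r y (-1) (app b y).

(** The value at [y] of the operator [(lam - b) (r^2 - b^2)], computed in two
    ways: by substituting the eigenvalue equations, and through the decomposition
    [(lam - r) (r^2 - b^2) + (r - b)^2 (r + b)], whose two terms are semidefinite
    when [r <= lam]. *)
Lemma bordered_identity :
  t ^+ 2 * (r ^+ 2 * lam + lam * dot c c + dot c (app b c) - lam ^+ 3) =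
  (lam - r) * (r ^+ 2 * dot y y - dot (app b y) (app b y))
  + (r * dot w w + dot w (app b w)).
Proof.
have cby : dot c (app b y) = lam ^+ 2 * t - t * dot c c.
  by rewrite (eq_dotr _ by_eq) dot_combr cy_eq; ring.
have p2 : dot (app b y) (app b y) =
    lam ^+ 2 * dot y y - 2 * lam ^+ 2 * t ^+ 2 + t ^+ 2 * dot c c.
  by rewrite [LHS](eq_dotr _ by_eq) dot_combr dotC bordered_form (dotC _ c) cby; ring.
have p3 : dot (app b y) (app b (app b y)) =
    lam * dot (app b y) (app b y) - t * lam * dot c (app b y)
    + t ^+ 2 * dot c (app b c).
  rewrite [LHS](eq_dotr _ (eq_app b by_eq)) [LHS](eq_dotr _ (app_comb _ _ _ _ _)).
  rewrite dot_combr (dotC _ (app b c)) (eq_dotr (app b c) by_eq) dot_combr.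
  by rewrite -(dot_app c y bsym) (dotC (app b c) c); ring.
rewrite /w form_comb // dot_comb p3 (dot_app y (app b y) bsym) p2 cby.
by rewrite bordered_form; ring.
Qed.

Lemma bordered_cubic : r <= lam -> t != 0 ->
  lam ^+ 3 <= r ^+ 2 * lam + lam * dot c c + dot c (app b c).
Proof.
move=> rlam t0; have t2 : 0 < t ^+ 2 by rewrite exprn_even_gt0.
rewrite -subr_ge0 -(pmulr_rge0 _ t2) bordered_identity addr_ge0 ?form_ge //.
by rewrite mulr_ge0 ?subr_ge0 // norm_app_le.
Qed.

(** Both terms of the identity vanish; the second says that [w = r y - b y] is
    isotropic for the semidefinite form of [r I + b], so [(r + b) (r - b) y = 0]. *)
Lemma bordered_cubic_eq : r <= lam ->
  lam ^+ 3 = r ^+ 2 * lam + lam * dot c c + dot c (app b c) ->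
  app b (app b y) =1 (fun i => r ^+ 2 * y i).
Proof.
move=> rlam e i; have := bordered_identity; rewrite e subrr mulr0 => /esym/eqP.
rewrite paddr_eq0 ?form_ge ?mulr_ge0 ?subr_ge0 ?norm_app_le // => /andP [_ /eqP w0].
have := @form_eq0_ker _ _ (shift r 1 b) w (shift_sym _ _ bsym).
rewrite form_shift mul1r => h.
have /h : forall u, 0 <= dot u (app (shift r 1 b) u).
  by move=> u; rewrite form_shift mul1r form_ge.
move=> /(_ w0 i); rewrite app_shift mul1r app_comb /w /comb; lra.
Qed.

(** The vector [t c = lam y - b y] lies in the eigenspace of [b^2] that contains
    [y], since [b] commutes with [b^2]. *)
Lemma bordered_sqr_border : t != 0 ->
  app b (app b y) =1 (fun i => r ^+ 2 * y i) ->
  app b (app b c) =1 (fun i => r ^+ 2 * c i).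
Proof.
move=> t0 e i; apply: (mulfI t0).
have ce : comb 0 y t c =1 comb lam y (-1) (app b y).
  by move=> j; rewrite /comb by_eq /comb; ring.
have := eq_app b (eq_app b ce) i.
rewrite !(eq_app b (app_comb _ _ _ _ _)) !app_comb /comb.
rewrite (eq_app b e) e.
have -> : app b (fun i => r ^+ 2 * y i) i = r ^+ 2 * app b y i.
  by rewrite /app mulr_sumr; apply: eq_bigr => j _; ring.
by rewrite by_eq /comb => h; lra.
Qed.

End Bordered.

(** * Complete graphs and stars *)

Section Shapes.
Implicit Types G : sgraph.

Definition is_complete G := forall x y : G, adj x y = (x != y).

Definition is_star G (w : G) := forall x y : G, adj x y = (x == w) (+) (y == w).

Lemma isomorphic_completeP G : isomorphic G (complete #|G|) <-> is_complete G.
Proof.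
split=> [[f [f_bij f_adj]] x y|Gc].
  by rewrite -f_adj /= /complete_adj (inj_eq (bij_inj f_bij)).
exists enum_rank; split=> [|x y]; first exact: enum_rank_bij.
by rewrite Gc /= /complete_adj (inj_eq enum_rank_inj).
Qed.

(** The centre corresponds to the only element of ['I_1]; conversely the leaves
    are numbered by the enumeration of the complement of the centre. *)
Lemma isomorphic_starP G :
  isomorphic G (complete_bipartite 1 #|G|.-1) <-> exists w : G, is_star w.
Proof.
split=> [[f [[g fK gK] f_adj]]|[w Gw]].
  have center x : (x == g (inl ord0)) = if f x is inl _ then true else false.
    rewrite -(can_eq fK) gK.
    by case: (f x) => // i; rewrite (ord1 i) eqxx.
  exists (g (inl ord0)) => x y; rewrite -f_adj !center.
  by case: (f x) (f y) => ? [].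
have rk_lt (x : {u : G | u != w}) : (enum_rank x < #|G|.-1)%N.
  apply: leq_trans (ltn_ord _) _.
  by rewrite card_sig cardC1.
pose f (x : G) : complete_bipartite 1 #|G|.-1 :=
  if insub x is Some u then inr (Ordinal (rk_lt u)) else inl ord0.
have fw : f w = inl ord0 by rewrite /f insubF ?eqxx.
have fN x (xw : x != w) : f x = inr (Ordinal (rk_lt (Sub x xw))).
  by rewrite /f insubT.
exists f; split=> [|x y]; last first.
  rewrite Gw; have [->|xw] := eqVneq x w; have [->|yw] := eqVneq y w;
    by rewrite ?fw ?(fN _ xw) ?(fN _ yw).
apply: inj_card_bij => [x y|].
  have [->|xw] := eqVneq x w; have [->|yw] := eqVneq y w;
    rewrite ?fw ?(fN _ xw) ?(fN _ yw) // => -[].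
  by move=> /ord_inj /enum_rank_inj /(congr1 val).
rewrite card_sum !card_ord add1n prednK //; apply/card_gt0P; by exists w.
Qed.

Lemma is_complete_del G (v : G) : is_complete G -> is_complete (del_vertex v).
Proof. by move=> Gc x y; rewrite /= /del_adj Gc. Qed.

Lemma is_star_del G (v w : G) (wv : w != v) : is_star w ->
  is_star (exist _ w wv : del_vertex v).
Proof. by move=> Gw x y; rewrite /= /del_adj Gw. Qed.

Lemma card_del_vertex G (v : G) : #|del_vertex v| = #|G|.-1.
Proof. by rewrite card_sig cardC1. Qed.

Lemma degree_complete G (v : G) : is_complete G -> degree v = #|G|.-1.
Proof.
move=> Gc; rewrite /degree -(cardC1 v); apply: eq_card => u.
by rewrite inE Gc !inE eq_sym.
Qed.

Lemma complete_of_degree G :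
  (forall v : G, (#|G|.-1 <= degree v)%N) -> is_complete G.
Proof.
move=> Gd x y; have sub : [set u | adj x u] \subset [set~ x].
  by apply/fintype.subsetP => u; rewrite !inE; apply: contraTneq => ->; rewrite adj_irr.
have /eqP/setP/(_ y) : [set u | adj x u] == [set~ x].
  by rewrite eqEcard sub cardsC1 Gd.
by rewrite !inE eq_sym.
Qed.

Lemma connected_degree_gt0 G (v : G) : connected G -> (1 < #|G|)%N ->
  (0 < degree v)%N.
Proof.
move=> [_ Gc] /card_gt1P [x [y [_ _ xy]]].
have [u uv] : exists u, u != v.
  by have [xv|] := eqVneq x v; [exists y; rewrite -xv eq_sym | exists x].
apply/card_gt0P; have /connectP [p] := Gc v u.
case: p => [_ uE|z p /andP [vz _] _]; first by rewrite uE eqxx in uv.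
by exists z; rewrite inE.
Qed.

(** A star whose centre is also a leaf is a single edge. *)
Lemma complete_of_star_degree1 (G : sgraph) (v : G) :
  is_star v -> degree v = 1%N -> is_complete G.
Proof.
move=> Gv deg1 i j; rewrite Gv.
have [->|iv] := eqVneq i v; first by rewrite eq_sym.
have [->|jv] := eqVneq j v; first by rewrite addbT iv.
have /card_le1_eqP only1 : (#|[set u | adj v u]| <= 1)%N by rewrite -/(degree v) deg1.
by rewrite (only1 i j) ?eqxx // inE Gv eqxx ?(negPf iv) ?(negPf jv).
Qed.

Variable R : realType.

Lemma sum_indicator (V : finType) (P : pred V) : \sum_i (P i)%:R = #|[pred i | P i]|%:R :> R.
Proof.
by rewrite -sum1_card natr_sum [RHS]big_mkcond; apply: eq_bigr => i _; rewrite inE; case: (P i).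
Qed.

Lemma sum_neq (V : finType) (i : V) : \sum_j (j != i)%:R = #|V|.-1%:R :> R.
Proof. by rewrite sum_indicator -(cardC1 i); congr _%:R; apply: eq_card. Qed.

Lemma rho_complete G : (0 < #|G|)%N -> is_complete G -> rho R G = #|G|.-1%:R.
Proof.
move=> G0 Gc.
have A1 y (a : R) : y =1 (fun=> a) ->
    app (@adj_ker R G) y =1 (fun=> #|G|.-1%:R * a).
  move=> ya i; rewrite -(sum_neq i) mulr_suml; apply: eq_bigr => j _.
  by rewrite ya /adj_ker Gc eq_sym.
have sqr : rho R G ^+ 2 = #|G|.-1%:R ^+ 2.
  apply: (rho_sqr_positive (x := fun=> 1)) => // i.
  by rewrite (A1 _ _ (A1 _ 1 (fun=> erefl))) mulrA.
by apply/eqP; rewrite -(@eqrXn2 _ 2) ?rho_ge0 ?ler0n // sqr.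
Qed.

(** The adjacency operator maps the constant 1 to [n - 1] at the centre and 1 at
    the leaves, and a second application makes it constant again. *)
Lemma rho_star G (w : G) : is_star w -> rho R G ^+ 2 = #|G|.-1%:R.
Proof.
move=> Gw; apply: (rho_sqr_positive (x := fun=> 1)) => // [|i].
  by apply/card_gt0P; exists w.
have app_w y : app (@adj_ker R G) y w = \sum_j (j != w)%:R * y j.
  by apply: eq_bigr => j _; rewrite /adj_ker Gw eqxx.
have app_l y j : j != w -> app (@adj_ker R G) y j = y w.
  move=> jw; rewrite /app (bigD1 w) //= big1 => [|l lw].
    by rewrite /adj_ker Gw eqxx (negPf jw) mul1r addr0.
  by rewrite /adj_ker Gw (negPf lw) (negPf jw) mul0r.
rewrite mulr1 -(sum_neq w); have [->|iw] := eqVneq i w; last first.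
  by rewrite app_l // app_w; apply: eq_bigr => j _; rewrite mulr1.
rewrite app_w; apply: eq_bigr => j _.
by have [->|jw] := eqVneq j w; rewrite ?mul0r // app_l // mulr1.
Qed.

End Shapes.

(** * Deleting a vertex *)

Section VertexDeletion.
Variables (R : realType) (G : sgraph) (v : G).
Local Notation A := (@adj_ker R G).
Local Notation B := (@del_ker R G v).
Local Notation rhoG := (rho R G).
Local Notation rhoD := (rho R (del_vertex v)).
Local Notation d := ((degree v)%:R : R).

Definition nbr : G -> R := fun i => (adj v i)%:R.

Lemma sum_nbr : \sum_i nbr i = d.
Proof. by rewrite sum_indicator /degree cardsE. Qed.

Lemma nbr_idem i : nbr i * nbr i = nbr i.
Proof. by rewrite /nbr; case: adj; rewrite ?mulr1 ?mulr0. Qed.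

Lemma dot_nbr : dot nbr nbr = d.
Proof. by rewrite -sum_nbr; apply: eq_bigr => i _; rewrite nbr_idem. Qed.

Lemma nbr_v : nbr v = 0.
Proof. by rewrite /nbr adj_irr. Qed.

(** The adjacency operator maps the indicator of [v] to [nbr]. *)
Lemma degree_le_rho_sqr : d <= rhoG ^+ 2.
Proof.
pose e : G -> R := fun i => (i == v)%:R.
have e1 : dot e e = 1.
  rewrite /dot (bigD1 v) //= big1 => [|i /negPf iv]; rewrite /e.
    by rewrite eqxx mulr1 addr0.
  by rewrite iv mulr0.
have Ae : app A e =1 nbr.
  move=> i; rewrite /app (bigD1 v) //= big1 => [|j /negPf jv]; rewrite /e.
    by rewrite eqxx mulr1 addr0 /adj_ker adj_sym.
  by rewrite jv mulr0.
have := norm_app_le (@adj_ker_sym R G) (rho_ge0 R G) (@rayleigh_rho_abs R G) e.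
by rewrite e1 mulr1 (eq_dotr _ Ae) dotC (eq_dotr _ Ae) dot_nbr.
Qed.

(** Both sides count the ordered pairs of distinct non-adjacent neighbours of
    [v]: the defect of the neighbourhood from being a clique. *)
Lemma nbr_form_defect : d ^+ 2 - d - dot nbr (app B nbr) =
  \sum_i \sum_j nbr i * nbr j * ((i != j)%:R - B i j).
Proof.
have -> : d ^+ 2 - d = \sum_i \sum_j nbr i * nbr j * (i != j)%:R.
  rewrite -[in X in _ - X]sum_nbr expr2 -{1}sum_nbr mulr_suml -sumrB.
  apply: eq_bigr => i _; rewrite -sum_nbr mulr_sumr (bigD1 i) //= [RHS](bigD1 i) //=.
  rewrite eqxx mulr0 add0r nbr_idem addrAC subrr add0r.
  by apply: eq_bigr => j ji; rewrite eq_sym ji mulr1.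
rewrite /dot -sumrB; apply: eq_bigr => i _; rewrite /app mulr_sumr -sumrB.
by apply: eq_bigr => j _; ring.
Qed.

Lemma nbr_defect_ge0 i j : 0 <= nbr i * nbr j * ((i != j)%:R - B i j).
Proof.
apply: mulr_ge0; first by rewrite mulr_ge0 ?ler0n.
rewrite subr_ge0 /del_ker ler_nat.
by have [->|ij] := eqVneq i j; rewrite ?adj_irr ?andbF ?leq_b1.
Qed.

Lemma nbr_form_le : dot nbr (app B nbr) <= d ^+ 2 - d.
Proof.
rewrite -subr_ge0 nbr_form_defect; do 2!apply: sumr_ge0 => ? _.
exact: nbr_defect_ge0.
Qed.

Lemma nbr_form_eq_clique i j : dot nbr (app B nbr) = d ^+ 2 - d ->
  adj v i -> adj v j -> i != j -> adj i j.
Proof.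
move=> e vi vj ij; have /esym/eqP := nbr_form_defect; rewrite e subrr.
rewrite psumr_eq0 => [/allP /(_ i (mem_index_enum _))|k _]; last first.
  by apply: sumr_ge0 => l _; exact: nbr_defect_ge0.
rewrite psumr_eq0 => [/allP /(_ j (mem_index_enum _))|k _]; last exact: nbr_defect_ge0.
rewrite /nbr vi vj ij !mul1r subr_eq0 /del_ker.
by case: adj; rewrite // !andbF oner_eq0.
Qed.

Section Eigenvector.
Variable x : G -> R.
Hypothesis xA : app A x =1 (fun i => rhoG * x i).

Definition off_v : G -> R := fun i => (i != v)%:R * x i.

Lemma app_off_v : app B off_v =1 comb rhoG off_v (- x v) nbr.
Proof.
move=> i; rewrite /comb /off_v; have [->|iv] := eqVneq i v.
  rewrite nbr_v mul0r !mulr0 addr0 /app big1 // => j _.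
  by rewrite /del_ker eqxx mul0r.
rewrite mul1r -xA /app (bigD1 v) //= [in RHS](bigD1 v) //= eqxx mul0r mulr0 add0r.
rewrite /adj_ker adj_sym -/(nbr i) addrAC mulNr (mulrC (x v)) subrr add0r.
by apply: eq_bigr => j jv; rewrite /del_ker iv jv mul1r.
Qed.

Lemma dot_nbr_off_v : dot nbr off_v = rhoG * x v.
Proof.
rewrite -xA; apply: eq_bigr => i _; rewrite /off_v; have [->|] := eqVneq i v.
  by rewrite nbr_v mul0r /adj_ker adj_irr mul0r.
by rewrite mul1r.
Qed.

End Eigenvector.

Lemma rho_gt0 : (0 < degree v)%N -> 0 < rhoG.
Proof.
move=> d0; have := degree_le_rho_sqr; rewrite lt_def rho_ge0 andbT => h.
apply: contraTneq h => ->; rewrite expr0n /= -ltNge; by rewrite ltr0n.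
Qed.

(** If the eigenvector were supported on [v], the equation at [v] would give
    [rho x v = 0]. *)
Lemma off_v_gt0 x : app A x =1 (fun i => rhoG * x i) -> (exists i, x i != 0) ->
  0 < rhoG -> 0 < dot (off_v x) (off_v x).
Proof.
move=> xA [i xi] rho0; rewrite lt_def dot_ge0 andbT.
apply: contraNneq xi => /dot_eq0 off0.
have := dot_nbr_off_v xA; rewrite /dot big1 => [/esym/eqP|j _]; last first.
  by rewrite off0 mulr0.
rewrite mulf_eq0 gt_eqF //= => /eqP xv.
have [->|iv] := eqVneq i v; first by rewrite xv.
by have := off0 i; rewrite /off_v iv mul1r => ->.
Qed.

Lemma rho_del_rayleigh : (0 < degree v)%N -> rhoG ^+ 2 - d <= rhoD * rhoG.
Proof.
move=> d0; have r0 := rho_gt0 d0.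
have [x [_ xn0 xA]] : exists x, [/\ forall i, 0 <= x i, exists i, x i != 0 &
    app A x =1 (fun i => rhoG * x i)] by apply: perron; apply/card_gt0P; exists v.
rewrite -dot_nbr.
exact: (bordered_rayleigh (@rayleigh_del_ker R G v) (app_off_v xA)
  (dot_nbr_off_v xA) r0 (off_v_gt0 xA xn0 r0)).
Qed.

(** The value of the eigenvector at [v] is nonzero, since otherwise [rho] would
    be an eigenvalue of [G - v]. *)
Lemma rho_del_cubic : rhoD < rhoG ->
  rhoG ^+ 3 <= rhoD ^+ 2 * rhoG + rhoG * d + dot nbr (app B nbr).
Proof.
move=> rr; have r0 : 0 < rhoG by apply: le_lt_trans rr; exact: rho_ge0.
have [x [_ xn0 xA]] : exists x, [/\ forall i, 0 <= x i, exists i, x i != 0 &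
    app A x =1 (fun i => rhoG * x i)] by apply: perron; apply/card_gt0P; exists v.
rewrite -dot_nbr.
apply: (bordered_cubic (@del_ker_sym R G v) (rho_ge0 _ _) (@rayleigh_del_ker R G v)
  (app_off_v xA) (dot_nbr_off_v xA) (ltW rr)).
apply: contraTneq rr => xv; rewrite -leNgt.
have y0 := off_v_gt0 xA xn0 r0.
have := le_trans (ler_norm _) (rayleigh_del_ker v (off_v x)).
rewrite (bordered_form (app_off_v xA) (dot_nbr_off_v xA)) xv expr0n subr0.
by rewrite ler_pM2r.
Qed.

(** After squaring [rho^2 - d <= r rho], the slack of the bound times [rho^2] is
    the slack of the squared inequality plus [(rho - d)^2]; equality kills both. *)
Lemma sqr_rho_drop_le_rayleigh : (0 < degree v)%N ->
  rhoG ^+ 2 - rhoD ^+ 2 <= 2 * d + 1 - 2 * (d / rhoG) /\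
  (rhoG ^+ 2 - rhoD ^+ 2 = 2 * d + 1 - 2 * (d / rhoG) ->
   rhoG = d /\ rhoD * rhoG = rhoG ^+ 2 - d).
Proof.
move=> d0; have r0 := rho_gt0 d0; have h := rho_del_rayleigh d0.
have dr := degree_le_rho_sqr; have dR : 0 < d by rewrite ltr0n.
have h2 : (rhoG ^+ 2 - d) ^+ 2 <= (rhoD * rhoG) ^+ 2.
  by rewrite lerXn2r // nnegrE ?subr_ge0 // mulr_ge0 ?rho_ge0.
have r2 : 0 < rhoG ^+ 2 by rewrite exprn_gt0.
have key : rhoG ^+ 2 * (2 * d + 1 - 2 * (d / rhoG) - (rhoG ^+ 2 - rhoD ^+ 2)) =
   (rhoG - d) ^+ 2 + ((rhoD * rhoG) ^+ 2 - (rhoG ^+ 2 - d) ^+ 2).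
  by field; rewrite gt_eqF.
split; first by rewrite -subr_ge0 -(pmulr_rge0 _ r2) key addr_ge0 ?sqr_ge0 // subr_ge0.
move=> e; move: key; rewrite e subrr mulr0 => /esym/eqP.
rewrite paddr_eq0 ?sqr_ge0 ?subr_ge0 // sqrf_eq0 !subr_eq0 => /andP [/eqP rd].
by rewrite eqrXn2 ?subr_ge0 ?mulr_ge0 ?rho_ge0 // => /eqP.
Qed.

(** When [rho <= r] the drop is not positive and the bound is trivial (and strict
    if [v] has a neighbour). Otherwise the slack times [rho] is the slack of the
    cubic inequality plus the clique defect. *)
Lemma sqr_rho_drop_le_cubic :
  rhoG ^+ 2 - rhoD ^+ 2 <= d + (d ^+ 2 - d) / rhoG /\
  ((0 < degree v)%N -> rhoG ^+ 2 - rhoD ^+ 2 = d + (d ^+ 2 - d) / rhoG ->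
   [/\ rhoD < rhoG, dot nbr (app B nbr) = d ^+ 2 - d &
     rhoG ^+ 3 = rhoD ^+ 2 * rhoG + rhoG * d + dot nbr (app B nbr)]).
Proof.
have d1 : d <= d ^+ 2 by rewrite -natrX ler_nat; case: degree => // n; rewrite -mulnn leq_pmulr.
have g0 := rho_ge0 R G; have D0 := rho_ge0 R (del_vertex v).
have rhs0 : 0 <= (d ^+ 2 - d) / rhoG by rewrite divr_ge0 // subr_ge0.
have [le_rho|rr] := leP rhoG rhoD.
  have le2 : rhoG ^+ 2 <= rhoD ^+ 2 by rewrite lerXn2r.
  split=> [|dpos]; first by apply: (@le_trans _ _ 0); [rewrite subr_le0 | rewrite addr_ge0 ?ler0n].
  by move: dpos; rewrite -(ltr0n R) => dpos; lra.
have r0 : 0 < rhoG by apply: le_lt_trans rr.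
have h := rho_del_cubic rr; have hE := nbr_form_le.
have key : rhoG * (d + (d ^+ 2 - d) / rhoG - (rhoG ^+ 2 - rhoD ^+ 2)) =
    (rhoD ^+ 2 * rhoG + rhoG * d + dot nbr (app B nbr) - rhoG ^+ 3)
    + (d ^+ 2 - d - dot nbr (app B nbr)).
  by field; rewrite gt_eqF.
split; first by rewrite -subr_ge0 -(pmulr_rge0 _ r0) key addr_ge0 // subr_ge0.
move=> _ e; move: key; rewrite e subrr mulr0 => /esym/eqP.
rewrite paddr_eq0 ?subr_ge0 // !subr_eq0 => /andP [/eqP e1 /eqP e2].
by split.
Qed.

(** Proportionality of [off_v x] to [nbr] and positivity of [x] make every vertex
    a neighbour of [v] and [x] constant; a constant eigenvector means that the
    graph is regular. *)
Lemma complete_of_rayleigh_eq : connected G -> (0 < degree v)%N ->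
  rhoG = d -> rhoD * rhoG = rhoG ^+ 2 - d -> is_complete G.
Proof.
move=> Gc d0 rd e; have r0 := rho_gt0 d0; have dR : 0 < d by rewrite ltr0n.
have [x [x0 xn0 xA]] := perron R Gc.1.
have xpos := perron_gt0 Gc x0 xn0 xA.
have near i : i != v -> adj v i /\ x i = x v.
  move=> iv; have := bordered_rayleigh_eq (@rayleigh_del_ker R G v) (app_off_v xA)
    (dot_nbr_off_v xA) r0 (off_v_gt0 xA xn0 r0).
  rewrite dot_nbr => /(_ dR e i); rewrite rd -mulrA /off_v iv mul1r.
  move=> /(mulfI (lt0r_neq0 dR)); move: (xpos i); rewrite /nbr.
  by case: adj => [_|/[swap] ->]; rewrite ?mulr1 // mulr0 ltxx.
have deg_v : degree v = #|G|.-1.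
  rewrite -(cardC1 v); apply: eq_card => u; rewrite inE !inE.
  by have [->|/near [->]] := eqVneq u v; rewrite ?adj_irr.
apply: complete_of_degree => u; rewrite -deg_v.
have x_const i : x i = x v by have [->|/near []] := eqVneq i v.
suff : degree u = degree v by move=> ->.
apply/eqP; rewrite -(eqr_nat R) -rd; apply/eqP.
apply: (mulIf (lt0r_neq0 (xpos v))); rewrite -{2}(x_const u) -xA /app.
have -> : (degree u)%:R = \sum_i (adj u i)%:R :> R.
  by rewrite sum_indicator /degree cardsE.
by rewrite mulr_suml; apply: eq_bigr => i _; rewrite x_const.
Qed.

(** Evaluating [B^2 c = r^2 c] at a non-neighbour [u] of [v] excludes walks
    [u - j - k] in [G - v] ending at a neighbour [k] of [v] ([no_walk]).
    Evaluating [B^2 y = r^2 y] there gives [x v * B c u = (rho^2 - r^2) * x u > 0],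
    so [u] has a neighbour among those of [v] ([attach]). *)
Lemma shape_of_cubic_eq : connected G -> rhoD < rhoG ->
    dot nbr (app B nbr) = d ^+ 2 - d ->
    rhoG ^+ 3 = rhoD ^+ 2 * rhoG + rhoG * d + dot nbr (app B nbr) ->
  is_complete G \/ degree v = 1%N /\ exists w : G, is_star w.
Proof.
move=> Gc rr clique cubic.
have [x [x0 xn0 xA]] := perron R Gc.1.
have xpos := perron_gt0 Gc x0 xn0 xA.
have bsq : app B (app B (off_v x)) =1 (fun i => rhoD ^+ 2 * off_v x i).
  apply: (bordered_cubic_eq (@del_ker_sym R G v) (rho_ge0 _ _) (@rayleigh_del_ker R G v)
    (app_off_v xA) (dot_nbr_off_v xA) (ltW rr)).
  by rewrite dot_nbr.
have csq := bordered_sqr_border (app_off_v xA) (lt0r_neq0 (xpos v)) bsq.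
have B_ge0 i j : 0 <= B i j by exact: ler0n.
have no_walk u j k : u != v -> ~~ adj v u -> adj u j -> adj j k -> j != v -> k != v ->
    ~~ adj v k.
  move=> uv vu uj jk jv kv; have := csq u; rewrite {2}/nbr (negPf vu) mulr0 => /eqP.
  rewrite psumr_eq0 => [/allP /(_ j (mem_index_enum _))|l _]; last first.
    by rewrite mulr_ge0 // sumr_ge0 // => l' _; rewrite mulr_ge0 ?ler0n.
  rewrite {1}/del_ker uv jv uj mul1r.
  rewrite psumr_eq0 => [/allP /(_ k (mem_index_enum _))|l _]; last first.
    by rewrite mulr_ge0 ?ler0n.
  by rewrite /del_ker jv kv jk mul1r /nbr pnatr_eq0 eqb0.
have attach u : u != v -> ~~ adj v u -> exists2 w, adj v w & adj u w.
  move=> uv vu; apply/exists2P.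
  suff : [exists w, adj v w && adj u w].
    by move=> /existsP [w /andP []]; exists w.
  apply: contraT => /existsPn no_w.
  have Bc : app B nbr u = 0.
    rewrite /app big1 // => j _; rewrite /del_ker /nbr.
    by have := no_w j; case: (adj v j); rewrite ?mulr0 //= => /negPf ->; rewrite !andbF mul0r.
  have := bsq u; rewrite (eq_app _ (app_off_v xA)) app_comb /comb Bc mulr0 addr0.
  rewrite (app_off_v xA) /comb {1}/nbr (negPf vu) mulr0 addr0 mulrA -expr2.
  rewrite /off_v uv mul1r => /(mulIf (lt0r_neq0 (xpos u))) /eqP.
  by rewrite eqrXn2 ?rho_ge0 // gt_eqF.
have [/existsP [u /andP [uv vu]]|/existsPn all_near] :=
    boolP [exists u, (u != v) && ~~ adj v u]; last first.
  have near i : i != v -> adj v i.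
    by move=> iv; have := all_near i; rewrite iv negbK.
  left=> i j; have [->|ij] := eqVneq i j; first exact: adj_irr.
  have [iv|iv] := eqVneq i v; first by rewrite iv near // -iv eq_sym.
  have [jv|jv] := eqVneq j v; first by rewrite jv adj_sym near // -jv.
  exact: nbr_form_eq_clique (near _ iv) (near _ jv) ij.
right; have [w vw uw] := attach _ uv vu.
have neq_v k : adj v k -> k != v by apply: contraTneq => ->; rewrite adj_irr.
have wv := neq_v _ vw.
have only_w k : adj v k = (k == w).
  have [->//|kw] := eqVneq k w; apply/negbTE; apply/negP => vk.
  have wk : adj w k by apply: nbr_form_eq_clique clique vw vk _; rewrite eq_sym.
  by have := no_walk _ _ _ uv vu uw wk wv (neq_v _ vk); rewrite vk.
split; first by rewrite /degree -(cards1 w); apply: eq_card => k; rewrite !inE only_w.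
exists w.
have to_w k : k != w -> adj k w.
  move=> kw; have [->//|kv] := eqVneq k v.
  by have [|w'] := attach k kv; rewrite only_w // => /eqP ->.
have off_w i j : i != w -> j != w -> adj i j = false.
  move=> iw jw; have [->|iv] := eqVneq i v; first by rewrite only_w (negPf jw).
  have [->|jv] := eqVneq j v; first by rewrite adj_sym only_w (negPf iw).
  apply/negP => ij; suff : ~~ adj v w by rewrite vw.
  apply: (no_walk i j w) => //; first by rewrite only_w.
  exact: to_w.
move=> i j; have [->|iw] := eqVneq i w; have [->|jw] := eqVneq j w => /=.
- exact: adj_irr.
- by rewrite adj_sym to_w.
- exact: to_w.
- exact: off_w.
Qed.

End VertexDeletion.

(** * The inequality and its equality cases *)

Theorem corollary1p3 (R : realType) (G : sgraph) (n : nat) (hn : #|G| = n)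
    (v : G) (k : R) (hk : 0 <= k <= (degree v)%:R + 1) :
  let d : R := (degree v)%:R in
  let lhs : R := rho R G ^+ 2 - rho R (del_vertex v) ^+ 2 in
  let rhs : R := 2 * d - 1 + (k - 2) * (d / rho R G - 1) in
  lhs <= rhs /\
  (connected G -> (1 < n)%N ->
    (lhs = rhs <->
      isomorphic G (complete n) \/
      [/\ isomorphic G (complete_bipartite 1 n.-1), degree v = 1%N & k = 2])).
Proof.
move=> d lhs rhs.
case/andP: hk => k_ge0 k_le; rewrite -/d in k_le.
have d_ge0 : 0 <= d by exact: ler0n.
set r0 := 2 * d + 1 - 2 * (d / rho R G).
set r1 := d + (d ^+ 2 - d) / rho R G.
(* The right-hand side is affine in [k], with values [r0] at [0] and [r1] at
   [d + 1]. *)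
have mix : (d + 1) * (rhs - lhs) = (d + 1 - k) * (r0 - lhs) + k * (r1 - lhs).
  by rewrite /rhs /r0 /r1; ring.
have [le1 eq1] := sqr_rho_drop_le_cubic R v; rewrite -/d -/lhs -/r1 in le1 eq1.
have le0 : lhs <= r0.
  have [deg0|deg0] := posnP (degree v).
    by move: le1; rewrite /r0 /r1 /d deg0; lra.
  by have [] := sqr_rho_drop_le_rayleigh R deg0.
have d1 : 0 < d + 1 by lra.
have dk_ge0 : 0 <= d + 1 - k by rewrite subr_ge0.
split.
  by rewrite -subr_ge0 -(pmulr_rge0 _ d1) mix addr_ge0 // mulr_ge0 // subr_ge0.
move=> Gc; rewrite -hn => G1; rewrite isomorphic_completeP.
have deg0 := connected_degree_gt0 v Gc G1.
split=> [e|].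
  move: mix; rewrite e subrr mulr0 -e => /esym/eqP.
  rewrite paddr_eq0 ?mulr_ge0 ?subr_ge0 // !mulf_eq0 !subr_eq0.
  case/andP => /orP [/eqP kd|/eqP l0] h1.
    have /eqP l1 : r1 == lhs by case/orP: h1 => // /eqP k0; move: d1; rewrite kd k0 ltxx.
    have [rr cl cub] := eq1 deg0 (esym l1).
    have [|[deg1 [w star_w]]] := shape_of_cubic_eq Gc rr cl cub; first by left.
    by right; split=> //; [apply/isomorphic_starP; exists w | rewrite -kd /d deg1].
  left; have [_ /(_ (esym l0)) [rd e2]] := sqr_rho_drop_le_rayleigh R deg0.
  exact: complete_of_rayleigh_eq Gc deg0 rd e2.
have n0 := ltnW G1.
have [m Gm] : exists m, #|G| = m.+2 by case: #|G| G1 => [|[|m]] // _; exists m.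
have complete_case : is_complete G -> lhs = rhs.
  move=> Gcomp.
  have rG := rho_complete R n0 Gcomp.
  have rD : rho R (del_vertex v) = m%:R.
    rewrite rho_complete ?card_del_vertex ?Gm //.
    exact: is_complete_del.
  have m1 : m.+1%:R != 0 :> R by rewrite pnatr_eq0.
  rewrite /lhs /rhs /d rG rD (degree_complete v Gcomp) Gm /= divff //.
  by rewrite -natr1; ring.
case=> [//|[/isomorphic_starP [w star_w] deg1 k2]].
have [vw|wv] := eqVneq w v.
  (* Only possible for two vertices, where the centre is itself a leaf. *)
  by apply: complete_case; apply: complete_of_star_degree1 deg1; rewrite -vw.
have lG := rho_star R star_w.
have lD := rho_star R (is_star_del wv star_w).
rewrite /lhs /rhs lG lD card_del_vertex Gm /= /d deg1 k2 subrr mul0r addr0.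
by rewrite -natr1; ring.
Qed.
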